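(* Let $X$ and $Y$ be real Banach spaces, $U$ a neighborhood of $0$ in $X$, and $F:\Lambda\times U\to Y$ a $C^1$ map with $F(\lambda,0)=0$ for any $\lambda\in\Lambda$, where $\Lambda$ is an open interval in $\mathbb{R}$. Suppose that: 1. $\dim\operatorname{Ker}(D_uF(\mu,0))=k$ for some $\mu\in\Lambda$ and any $k\in\mathbb{N}$, where the basis vectors of $\operatorname{Ker}(D_uF(\mu,0))$ are denoted by $\{w_i\}_{i=1}^k$. 2. For any fixed $i\in\{1,\dots,k\}$, let $X_0$ be any complement of $\operatorname{Ker}(D_uF(\mu,0))$ and let $\widetilde F$ be the restriction of $F$ to $\Lambda\times\widetilde U$, with $\widetilde U$ being the restriction of $U$ to $\widetilde X:=\operatorname{span}\{w_i\}\oplus X_0$. Assume that $\widetilde Y\subseteq Y$ is a closed subspace of $Y$ such that the image of $\widetilde F$ is contained in $\widetilde Y$ and $$\dim\operatorname{Ker}\left(D_u\widetilde F(\mu,0)\right)=\operatorname{codim}\operatorname{Im}\left(D_u\widetilde F(\mu,0)\right).$$ 3. The double cross derivative $\widetilde F_{\lambda u}$ exists and is continuous. 4. $D_{\lambda u}\widetilde F(\mu,0)[w_i]\notin\operatorname{Im}\left(D_u\widetilde F(\mu,0)\right)$. Then there exist an open interval $I_0=(-\delta_0,\delta_0)$ and continuous functions $\lambda:I_0\to\mathbb{R}$ and $\psi:I_0\to X_0$ such that $\lambda(0)=\mu$, $\psi(0)=0$, and $F(\lambda(s),sw_i+s\psi(s))=0$ for $s\in I_0$; and $F^{-1}\{0\}$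 near $(\mu,0)$ consists precisely of the curves $u=0$ and $\Gamma=\{(\lambda(s),u(s)):s\in I_0\}$.
   Context: Points of $\Lambda\times U$ are written $(\lambda,u)$. $D_uF$ denotes the derivative in $u$ and $D_{\lambda u}$ (also written with subscript $\lambda u$) the mixed derivative in $\lambda$ and $u$. ''The restriction of $U$ to $\widetilde X$'' means $U\cap\widetilde X$. $D_u\widetilde F(\mu,0)$ is regarded as an operator from $\widetilde X$ to $\widetilde Y$, so its codimension is taken in $\widetilde Y$. In the definition of $\Gamma$, $u(s)=sw_i+s\psi(s)$.
   Formalization: The description of F^{-1}{0} near (μ,0) is stated only within Λ×X̃, since in Λ×X it fails for k>1 (e.g. F(λ,u)=λu on ℝ², X_0={0}, Ỹ=span{w_1}); the complement X_0 is taken to be closed. *)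

(* Defs.v *)
From HB Require Import structures.
From mathcomp Require Import all_boot all_order all_algebra.
From mathcomp Require Import all_classical all_reals all_analysis.

Set Implicit Arguments.
Unset Strict Implicit.
Unset Printing Implicit Defensive.
Import Order.TTheory GRing.Theory Num.Theory.
Import numFieldNormedType.Exports.
Local Open Scope classical_set_scope.
Local Open Scope ring_scope.

(* A linear subspace S of a normed space, as a normed space in its own right
   with the norm (hence the topology) inherited from the ambient space. *)
Definition subspace_type (R : realType) (V : normedModType R)
  (S : submodClosed V) : Type := {x : V | x \in S}.

Section SubspaceType.
Context (R : realType) (V : normedModType R) (S : submodClosed V).

HB.instance Definition _ := [isSub of subspace_type S for @sval V _].
HB.instance Definition _ := [Choice of subspace_type S by <:].
HB.instance Definition _ := [SubChoice_isSubLmodule of subspace_type S by <:].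

Definition sub_norm (x : subspace_type S) : R := `|val x|.

Fact sub_norm_le_add x y : sub_norm (x + y) <= sub_norm x + sub_norm y.
Proof. by rewrite /sub_norm raddfD ler_normD. Qed.

Fact sub_norm_scale (a : R) x : sub_norm (a *: x) = `|a| * sub_norm x.
Proof. by rewrite /sub_norm linearZ normrZ. Qed.

Fact sub_norm_eq0 x : sub_norm x = 0 -> x = 0.
Proof. by move/normr0_eq0 => x0; apply/val_inj; rewrite x0 raddf0. Qed.

HB.instance Definition _ := @Lmodule_isNormed.Build R (subspace_type S)
  sub_norm sub_norm_le_add sub_norm_scale sub_norm_eq0.

End SubspaceType.

Section LinePlus.
Context (R : realType) (V : normedModType R) (w : V) (S : submodClosed V).

(* span {w} + S *)
Definition line_plus : {pred V} :=
  fun x => `[< exists (a : R) (y : V), y \in S /\ x = a *: w + y >].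

Fact line_plus_submod : submod_closed line_plus.
Proof.
split; first by apply/asboolP; exists 0, 0; rewrite rpred0 scale0r addr0.
move=> c _ _ /asboolP[a [x [Sx ->]]] /asboolP[b [y [Sy ->]]].
apply/asboolP; exists (c * a + b), (c *: x + y); split.
  by rewrite rpredD// rpredZ.
by rewrite scalerDr scalerA scalerDl addrACA.
Qed.

HB.instance Definition _ :=
  GRing.isSubmodClosed.Build R V line_plus line_plus_submod.

Fact line_plus_gen_subproof : w \in (line_plus : submodClosed V).
Proof. by apply/asboolP; exists 1, 0; rewrite rpred0 scale1r addr0. Qed.

(* w, as a point of span {w} + S *)
Definition line_plus_gen : subspace_type line_plus :=
  exist _ w line_plus_gen_subproof.

End LinePlus.

Section LinearAlgebra.
Context (R : realType) (V : lmodType R).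
Implicit Types A N K : set V.

(* The classes of e form a basis of the quotient A / N, for linear subspaces
   N of A. *)
Definition is_basis_mod N A n (e : 'I_n -> V) : Prop :=
  [/\ N `<=` A,
      forall j, A (e j),
      forall c : 'I_n -> R, N (\sum_j c j *: e j) -> forall j, c j = 0
    & forall x, A x -> exists c : 'I_n -> R, N (x - \sum_j c j *: e j)].

Definition is_basis A n (e : 'I_n -> V) : Prop := is_basis_mod [set 0] A e.

Definition has_dim A n : Prop := exists e : 'I_n -> V, is_basis A e.

Definition has_codim_in A N n : Prop :=
  exists e : 'I_n -> V, is_basis_mod N A e.

Definition direct_sum_decomp K A : Prop :=
  K `&` A = [set 0] /\ forall x, exists a b, [/\ K a, A b & x = a + b].

End LinearAlgebra.

Definition ker (R : realType) (V W : lmodType R) (f : V -> W) : set V :=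
  f @^-1` [set 0].

(* Complement in the sense of Banach spaces: S is required to be closed. *)
Definition is_complement (R : realType) (V : normedModType R) (K : set V)
  (S : submodClosed V) : Prop :=
  closed [set` S] /\ direct_sum_decomp K [set` S].

(* Continuity on A of a family of linear operators in the operator norm. *)
Definition op_continuous_on (R : realType) (T : topologicalType)
    (V W : normedModType R) (A : set T) (D : T -> V -> W) : Prop :=
  forall p, A p -> forall e : R, 0 < e ->
    \forall q \near within A (nbhs p),
      forall v, `|D q v - D p v| <= e * `|v|.

(* For open A: f is a total function, so differentiability at a point of A
   must not depend on its values outside A. *)
Definition C1_on (R : realType) (V W : normedModType R) (A : set V)
    (f : V -> W) : Prop :=
  (forall p, A p -> differentiable f p) /\
  op_continuous_on A (fun p => 'd f p : V -> W).

Section PartialDerivatives.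
Context (R : realType) (X Y : normedModType R) (F : R * X -> Y).

Definition D_u (p : R * X) : X -> Y := 'd (fun u : X => F (p.1, u)) (p.2).

Definition D_l (p : R * X) : Y := derive1 (fun t : R => F (t, p.2)) p.1.

End PartialDerivatives.

(* F_{lambda u} = (F_lambda)_u *)
Definition D_lu (R : realType) (X Y : normedModType R) (F : R * X -> Y)
  (p : R * X) : X -> Y := D_u (D_l F) p.

Definition D_lu_exists_continuous_on (R : realType) (X Y : normedModType R)
    (A : set (R * X)) (F : R * X -> Y) : Prop :=
  (forall p, A p -> differentiable (fun u : X => D_l F (p.1, u)) p.2) /\
  op_continuous_on A (D_lu F).

(* The restriction of F to R x S. Its values stay in Y, so that the derivatives
   D_u (restr F) p are operators from S to Y. *)
Definition restr (R : realType) (X Y : normedModType R) (S : submodClosed X)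
  (F : R * X -> Y) : R * subspace_type S -> Y := fun p => F (p.1, val p.2).

(* Main.v *)
Require Import Defs.
From HB Require Import structures.
From mathcomp Require Import all_boot all_order all_algebra.
From mathcomp Require Import all_classical all_reals all_analysis.
From mathcomp Require Import ring lra.

Set Implicit Arguments.
Unset Strict Implicit.
Unset Printing Implicit Defensive.
Import Order.TTheory GRing.Theory Num.Theory.
Import numFieldNormedType.Exports.
Local Open Scope classical_set_scope.
Local Open Scope ring_scope.

(** Write X~ = span w + X0 and blow up the equation along the trivial branch:
    for s <> 0, u = s (w + x) with x in X0 is a zero of F(l, .) iff
    G_s(l, x) = s^-1 F(l, s (w + x)) vanishes.  Near s = 0 and (l, x) = (mu, 0),
    G_s differs by a small Lipschitz map from the affine map with linear part
    T(l, x) = l B w + A x, where A = D_u F~(mu, 0) and B = D_lu F~(mu, 0).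
    The dimension and transversality hypotheses make T a bijection from R x X0
    onto the Banach space Y~, hence bounded below by the open mapping theorem,
    and a Newton iteration solves G_s = 0 uniquely in a fixed ball around
    (mu, 0).  The bound |p - q| <= 2 M |G_s p - G_s q| gives both the continuity
    of the branch and, since zeros with u <> 0 satisfy |y| = o(|s|) for
    u = s w + y, local uniqueness. *)

(** * Mean value inequality *)

(** In a general normed space no intermediate point with equality need exist. The bound with slope
    [C + e] is instead propagated from [a] to [b] by a supremum argument, and then [e] tends to
    0. *)
Lemma mean_value_inequality (R : realType) (W : normedModType R) (g : R -> W)
    (a b C : R) :
  a <= b ->
  (forall t, a <= t <= b -> derivable g t 1) ->
  (forall t, a <= t <= b -> `|derive1 g t| <= C) ->
  `|g b - g a| <= C * (b - a).
Proof.
move=> ab dg gC.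
suff key e : 0 < e -> `|g b - g a| <= (C + e) * (b - a).
  move: ab; rewrite le_eqVlt => /predU1P[->|ab]; first by rewrite !subrr normr0 mulr0.
  rewrite -ler_pdivrMr ?subr_gt0//; apply/ler_addgt0Pr => e e0.
  by rewrite ler_pdivrMr ?subr_gt0//; exact: key.
move=> e0.
have loc t : a <= t <= b -> \forall h \near 0, `|g (h + t) - g t| <= (C + e) * `|h|.
  move=> tab; have := dg t tab; rewrite /derivable => /cvgrPdist_lt /(_ e e0).
  rewrite -/(derive g t 1) -derive1E; rewrite near_withinE => H0.
  near=> h; have [->|h0] := eqVneq h 0; first by rewrite add0r subrr !normr0 mulr0.
  rewrite -ler_pdivrMr ?normr_gt0//.
  have /= : `|derive1 g t - h^-1 *: (g (h *: 1 + t) - g t)| < e.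
    move: h0; near: h; exact: H0.
  rewrite [h *: 1]mulr1 => /ltW H; rewrite mulrC -normfV -normrZ.
  rewrite -(subrK (derive1 g t) (h^-1 *: _)) addrC (le_trans (ler_normD _ _))//.
  by rewrite lerD ?gC// distrC.
have /andP [a_ge b_ge] : (a <= a) && (a <= b) by rewrite lexx.
(* The supremum of S lies in S and, unless it is b, is not an upper bound. *)
pose S := [set t | a <= t <= b /\ `|g t - g a| <= (C + e) * (t - a)].
have Sa : S a by split; rewrite ?lexx// !subrr normr0 mulr0.
have Sub : ubound S b by move=> t [/andP[]].
have hS : has_sup S by split; [exists a|exists b].
have ub_c := sup_upper_bound hS; have c_lub := ge_sup (ex_intro _ a Sa) Sub.
set c := sup S in ub_c c_lub *.
have cab : a <= c <= b by rewrite ub_c.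
have /nbhs_ballP[d /= d0 dP] := loc c cab.
have {dP} dP h : `|h| < d -> `|g (h + c) - g c| <= (C + e) * `|h|.
  by move=> hd; apply: dP; rewrite -ball_normE/= sub0r normrN.
have Sc : S c.
  have [t [tab St]] := sup_adherent d0 hS; rewrite -/c => tc; split => //.
  have tc' : t <= c by apply: ub_c; split.
  have := dP (t - c); rewrite subrK ler0_norm ?subr_le0// => /(_ _)/wrap[].
    by lra.
  move=> H; rewrite -(subrK (g t) (g c)) -addrA (le_trans (ler_normD _ _))//.
  by rewrite distrC (le_trans (lerD H St))//; lra.
have [bc|cb] := leP b c.
  have <- : c = b by apply/eqP; rewrite eq_le bc; case/andP: cab => _ ->.
  by case: Sc.
pose h := Num.min (d / 2) (b - c).
have h0 : 0 < h by rewrite lt_min divr_gt0//= subr_gt0.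
have hd : `|h| < d by rewrite gtr0_norm// gt_min; apply/orP; left; lra.
have hbc : h <= b - c by rewrite ge_min lexx orbT.
have : S (h + c).
  case: Sc => /andP[ac _] Sc; split; first by apply/andP; split; lra.
  rewrite -(subrK (g c) (g (h + c))) -addrA (le_trans (ler_normD _ _))//.
  by have := dP h hd; rewrite (gtr0_norm h0); lra.
move=> /ub_c; lra.
Unshelve. all: by end_near. Qed.

(** * Complete spaces *)

HB.instance Definition _ (T U : puniformType) := Pointed.on (T * U)%type.

(** This makes [R * V] complete, as the Newton iteration on pairs (parameter, correction) requires.
    The limits of the two projections form the limit. *)
Lemma prod_cauchy_cvg (T U : completeType) (F : set_system (T * U)) :
  ProperFilter F -> cauchy F -> cvg F.
Proof.
move=> FF Fc.
have /cauchy_cvg/cvg_ex[l1 F1] : cauchy (fst @ F).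
  move=> A /= entA; rewrite near_simpl -near2E near_map2; apply: Fc.
  by apply: filterS (prod_entP entA entourageT) => xy [].
have /cauchy_cvg/cvg_ex[l2 F2] : cauchy (snd @ F).
  move=> A /= entA; rewrite near_simpl -near2E near_map2; apply: Fc.
  by apply: filterS (prod_entP entourageT entA) => xy [].
apply/cvg_ex; exists (l1, l2).
by apply: cvg_trans (cvg_pair F1 F2); apply: near_eq_cvg; apply: nearW => -[].
Qed.

HB.instance Definition _ (T U : completeType) :=
  Uniform_isComplete.Build (T * U)%type (@prod_cauchy_cvg T U).

HB.instance Definition _ (R : numFieldType) (T U : completeNormedModType R) :=
  Complete.on (T * U)%type.

Lemma norm_val (R : realType) (V : normedModType R) (S : submodClosed V)
  (x : subspace_type S) : `|val x| = `|x|.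
Proof. by []. Qed.

Lemma closed_subspace_cauchy_cvg (R : realType) (V : completeNormedModType R)
    (S : submodClosed V) (Sc : closed [set` S]) (F : set_system (subspace_type S)) :
  ProperFilter F -> cauchy F -> cvg F.
Proof.
move=> FF Fc.
have /cauchy_cvg/cvg_ex[l Fl] : cauchy (val @ F : set_system V).
  apply/cauchy_ballP => e e0; rewrite near_map2.
  by have /cauchy_ballP/(_ e e0) := Fc;
    apply: filterS => -[x y]; rewrite -!ball_normE.
have Sl : l \in S by apply: (closed_cvg _ Sc _ _ Fl); near=> x; exact: valP.
apply/cvg_ex; exists (exist _ l Sl); apply/cvgrPdist_lt => e e0.
by have /cvgrPdist_lt/(_ e e0) := Fl.
Unshelve. all: by end_near. Qed.

(** A packed structure rather than a canonical instance: completeness depends on the proof [Sc] that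
    [S] is closed. *)
Definition closed_subspace (R : realType) (V : completeNormedModType R)
    (S : submodClosed V) (Sc : closed [set` S]) : completeNormedModType R :=
  HB.pack (subspace_type S)
    (Uniform_isComplete.Build (subspace_type S) (closed_subspace_cauchy_cvg Sc)).

(** * Open mapping theorem *)

(* [N] is an approximate Newton step: the common core of the open mapping
   theorem (h x = T x - y) and of the resolution of the blown-up equation. *)
Lemma zero_of_halving (R : realType) (E : completeNormedModType R)
    (Y : normedModType R) (h : E -> Y) (N : E -> E) (x0 : E) (M r : R) :
  0 <= M -> 2 * M * `|h x0| <= r ->
  (forall x, `|x - x0| <= r -> {for x, continuous h}) ->
  (forall x, `|x - x0| <= r ->
     `|N x - x| <= M * `|h x| /\
     (`|N x - x0| <= r -> `|h (N x)| <= `|h x| / 2)) ->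
  exists2 x, `|x - x0| <= 2 * M * `|h x0| & h x = 0.
Proof.
move=> M0 h0r hc hN.
pose x n := iter n N x0; pose c := M * `|h x0|.
have c0 : 0 <= c by rewrite mulr_ge0.
have p0 n : 0 <= 2^-1 ^+ n :> R by rewrite exprn_ge0.
(* Step number n has length at most c 2^-n, and [2 * c * (1 - 2^-1 ^+ n)] is the sum of the first n
   such bounds. *)
have xP n : `|x n - x0| <= 2 * c * (1 - 2^-1 ^+ n) /\
    `|h (x n)| <= `|h x0| * 2^-1 ^+ n.
  elim: n => [|n [IH1 IH2]]; first by rewrite /x/= !expr0 !subrr normr0 !mulr0 mulr1.
  have xr : `|x n - x0| <= r.
    by have := p0 n; rewrite -mulrA -/c in h0r; nra.
  have [N1 N2] := hN _ xr.
  have Nx : `|x n.+1 - x0| <= 2 * c * (1 - 2^-1 ^+ n.+1).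
    rewrite /x iterS -/(x n) !exprSr.
    rewrite -(subrK (x n) (N (x n))) -addrA (le_trans (ler_normD _ _))//.
    have : M * `|h (x n)| <= c * 2^-1 ^+ n by rewrite -mulrA ler_wpM2l.
    by move=> H; rewrite (le_trans (lerD N1 IH1))//; lra.
  split=> //; rewrite exprSr mulrA (le_trans (N2 _)) ?ler_pM2r//.
  by rewrite (le_trans Nx)//; have := p0 n.+1; rewrite -mulrA -/c in h0r; nra.
have xr n : `|x n - x0| <= 2 * c.
  by have [+ _] := xP n; have := p0 n; nra.
have xr' n : `|x n - x0| <= r by rewrite (le_trans (xr n))// /c mulrA.
have half1 : `|2^-1 : R| < 1 by rewrite ger0_norm// invf_lt1// ltr1n.
pose u n := x n.+1 - x n.
have /normed_cvg/cvg_ex[l ul] : cvgn [normed series u].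
  apply: (series_le_cvg _ _ _ (is_cvg_geometric_series (a := c) half1)) => n //=.
    by rewrite mulr_ge0.
  have [N1 _] := hN _ (xr' n); rewrite /u/= (le_trans N1)// -mulrA ler_wpM2l//.
  by have [] := xP n.
have xl : x n @[n --> \oo] --> x0 + l.
  have -> : x = (fun n => x0 + series u n).
    by apply/funext => n; rewrite /series/= telescope_sumr// addrC subrK.
  by apply: cvgD => //; exact: cvg_cst.
have lr : `|x0 + l - x0| <= 2 * c.
  apply/ler_addgt0Pr => e e0.
  have /cvgrPdist_lt/(_ e e0) [n _ /(_ n (leqnn n)) /= xn] := xl.
  have -> : x0 + l - x0 = (x0 + l - x n) + (x n - x0) by rewrite addrA subrK.
  by rewrite (le_trans (ler_normD _ _))//; have := xr n; lra.
exists (x0 + l); first by rewrite -mulrA.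
have hl : h (x n) @[n --> \oo] --> h (x0 + l).
  by apply: continuous_cvg xl; apply: hc; rewrite (le_trans lr)// /c mulrA.
apply: (cvg_unique _ hl) => //; apply/cvgr0Pnorm_lt => e e0.
have /cvgr0Pnorm_lt/(_ e e0) := cvg_geometric `|h x0| half1.
apply: filterS => n /=; apply: le_lt_trans.
by have [_] := xP n; move/le_trans; apply; exact: ler_norm.
Qed.

Theorem bounded_preimage (R : realType) (E Y : completeNormedModType R)
    (T : {linear E -> Y}) :
  continuous T -> (forall y, exists x, T x = y) ->
  exists2 M : R, 0 < M & forall y, exists2 x, T x = y & `|x| <= M * `|y|.
Proof.
move=> Tc Tsurj.
(* By Baire, the closure of the image of some ball has interior; by symmetry and
   scaling, every y then has an approximate preimage with error |y| / 2, which
   [zero_of_halving] turns into an exact one. *)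
pose A n : set Y := closure [set T x | x in [set x | `|x| <= n%:R]].
have [n nd] : exists n, ~ dense (~` A n).
  apply: contrapT => /forallNP H.
  have /Baire : forall n, open (~` A n) /\ dense (~` A n).
    move=> n; split; last by apply: contrapT; exact: H.
    by rewrite openC; exact: closed_closure.
  move=> /(_ setT)[||y [_]]; first by exists 0.
    exact: openT.
  have [x xy] := Tsurj y.
  move=> /(_ (Num.truncn `|x|).+1 I); apply; apply: subset_closure.
  by exists x => //=; rewrite ltW// truncnS_gt.
have [y0 [r r0 yA]] : exists y0, exists2 r : R, 0 < r & ball y0 r `<=` A n.
  have [B [[y0 /open_nbhs_nbhs/nbhs_ballP[r r0 rB]] BA0]] := denseNE nd.
  exists y0, r => // y /rB By; apply: contrapT => nAy.
  by have := conj By nAy; rewrite -[_ /\ _]/((B `&` ~` A n) y) BA0.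
(* Approximate preimages of [y0 + y] and of [y0] are subtracted; hence the radius 2 n. *)
have sol0 (y : Y) e : `|y| < r -> 0 < e ->
    exists2 x, `|x| <= 2 * n%:R & `|y - T x| < e.
  move=> yr e0.
  have pick y' : A n y' -> exists2 x, `|x| <= n%:R & `|y' - T x| < e / 2.
    move=> /(_ (ball y' (e / 2)) (nbhsx_ballx _ _ _))[|_ [[x xn <-]]].
      by rewrite divr_gt0.
    by rewrite -ball_normE => xy; exists x.
  have [x1 x1n x1y] : exists2 x, `|x| <= n%:R & `|y0 + y - T x| < e / 2.
    apply/pick/yA; rewrite -ball_normE/=.
    by rewrite opprD addrA subrr sub0r normrN.
  have [x2 x2n x2y] := pick y0 (yA _ (ballxx _ r0)).
  exists (x1 - x2); first by rewrite (le_trans (ler_normB _ _))//; lra.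
  have -> : y - T (x1 - x2) = (y0 + y - T x1) - (y0 - T x2).
    by rewrite linearB !opprB [T x2 - y0]addrC [RHS]addrACA [y0 + y]addrC addrK
      [- T x1 + _]addrC.
  by rewrite (le_lt_trans (ler_normB _ _))//; lra.
(* Scaling [y] to norm r / 2 and scaling the preimage back multiplies the bound [2 * n%:R] by 2 |y|
   / r. *)
pose C := 4 * n%:R / r.
have C0 : 0 <= C by rewrite !mulr_ge0// invr_ge0 ltW.
have sol y : exists x, `|x| <= C * `|y| /\ `|y - T x| <= `|y| / 2.
  have [->|y0'] := eqVneq y 0.
    by exists 0; rewrite linear0 subr0 !normr0 mulr0 mul0r.
  have ny0 : 0 < `|y| by rewrite normr_gt0.
  pose k := r / (2 * `|y|); have k0 : 0 < k by rewrite divr_gt0// mulr_gt0.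
  have [||x xn xy] := sol0 (k *: y) (r / 4).
  - rewrite normrZ gtr0_norm// /k invfM mulrA mulfVK ?gt_eqF//; lra.
  - by rewrite divr_gt0.
  exists (k^-1 *: x); split.
    rewrite normrZ gtr0_norm ?invr_gt0//.
    have -> : C * `|y| = k^-1 * (2 * n%:R).
      by rewrite /C /k; field; rewrite !gt_eqF.
    by rewrite ler_pM2l ?invr_gt0.
  have -> : y - T (k^-1 *: x) = k^-1 *: (k *: y - T x).
    by rewrite scalerBr scalerA mulVf ?gt_eqF// scale1r linearZ.
  rewrite normrZ gtr0_norm ?invr_gt0//.
  have -> : `|y| / 2 = k^-1 * (r / 4) by rewrite /k; field; rewrite !gt_eqF.
  by rewrite ler_pM2l ?invr_gt0// ltW.
have [g gP] := choice sol.
(* The summand 1 keeps the constant positive even when [C] is 0. *)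
exists (2 * C + 1) => [|y]; first by lra.
have [||x _|x _|x xC xy] := @zero_of_halving R E Y (fun x => T x - y)
  (fun x => x + g (y - T x)) 0 C (2 * C * `|T 0 - y|).
- by [].
- by [].
- by apply: (@cvgB _ _ _ (nbhs x) _ T (cst y)); [exact: Tc|exact: cvg_cst].
- split=> [|_].
    rewrite [x + _]addrC addrK (le_trans (gP _).1)// distrC//.
  by rewrite linearD -normrN opprB opprD addrA distrC
    [`|T x - y|]distrC distrC (gP _).2.
exists x; first by apply/eqP; rewrite -subr_eq0 xy.
move: xC; rewrite subr0 linear0 sub0r normrN => /le_trans; apply.
by rewrite ler_wpM2r//; lra.
Qed.

(** * Strict partial derivatives *)

Lemma segment_norm_lt (R : realType) (V : normedModType R) (u v : V) (t d : R) :
  0 <= t <= 1 -> `|u| < d -> `|v| < d -> `|v + t *: (u - v)| < d.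
Proof.
move=> /andP[t0 t1] ud vd.
have -> : v + t *: (u - v) = (1 - t) *: v + t *: u.
  by rewrite scalerBr scalerBl scale1r addrAC addrA.
rewrite (le_lt_trans (ler_normD _ _))// !normrZ !ger0_norm ?subr_ge0//.
have : Num.max `|v| `|u| < d by rewrite gt_max vd.
set c := Num.max _ _; apply: le_lt_trans.
have vc : `|v| <= c by rewrite le_max lexx.
have uc : `|u| <= c by rewrite le_max lexx orbT.
by nra.
Qed.

(** The mean value inequality is applied to [g], whose derivative at t is the differential of [f] on
    the segment, applied to b - a, minus [L]. *)
Lemma diff_mean_value (R : realType) (V W : normedModType R) (f : V -> W)
    (a b : V) (L : W) (C : R) :
  (forall t : R, 0 <= t <= 1 -> differentiable f (a + t *: (b - a))) ->
  (forall t : R, 0 <= t <= 1 -> `|'d f (a + t *: (b - a)) (b - a) - L| <= C) ->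
  `|f b - f a - L| <= C.
Proof.
move=> df fC.
pose g (t : R) : W := f (a + t *: (b - a)) - t *: L.
have dg (t : R) : 0 <= t <= 1 ->
    is_diff t g (fun h => 'd f (a + t *: (b - a)) (h *: (b - a)) - h *: L).
  move=> t01; have dL : is_diff t ( *:%R^~ L) ( *:%R^~ L) := is_diff_scalel t L.
  have dp : is_diff t (fun t => a + t *: (b - a)) ( *:%R^~ (b - a)).
    apply: is_diff_eq (is_diffD (is_diff_cst a t) (is_diff_scalel t (b - a))) _.
    by apply/funext => h /=; rewrite [LHS]add0r.
  exact: is_diffB (is_diff_comp dp (differentiableP (df t t01))) dL.
have := @mean_value_inequality R W g 0 1 C ler01.
rewrite subr0 mulr1 /g scale0r addr0 scale1r subrKC scale1r scale0r subr0.
rewrite addrAC; apply => t t01.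
  by apply/derivable1_diffP; case: (dg t t01).
rewrite derive1E'; last by case: (dg t t01).
by case: (dg t t01) => _ ->; rewrite !scale1r; exact: fC.
Qed.

Section PartialDerivativeLemmas.
Context (R : realType) (X Y : normedModType R) (F : R * X -> Y).

Lemma differentiable_u (p : R * X) : differentiable F p ->
  differentiable (fun u => F (p.1, u)) p.2 /\
  (forall v, D_u F p v = 'd F p (0, v)).
Proof.
case: p => l u dF.
have d : is_diff (u : X) (fun u => F (l, u)) (fun v => 'd F (l, u) (0, v)).
  have du : is_diff u (fun v => (l, v)) (fun v => (0, v)).
    exact: (is_diff_pair (is_diff_cst l u) (is_diff_id u)).
  exact: is_diff_comp du (differentiableP dF).
split => [|v]; first by case: d.
by rewrite /D_u /=; case: d => _ ->.
Qed.

Lemma derivable_l (p : R * X) : differentiable F p ->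
  derivable (fun t => F (t, p.2)) p.1 1.
Proof.
case: p => l u dF; apply/derivable1_diffP.
apply: (differentiable_comp (f := fun t => (t, u)) (g := F)) => //.
Qed.

Lemma near_pair0P (mu : R) (P : R * X -> Prop) :
  (\forall p \near (mu, 0 : X), P p) ->
  exists2 d : R, 0 < d & forall l u, `|l - mu| < d -> `|u| < d -> P (l, u).
Proof.
move=> /nbhs_ballP[d d0 dP]; exists d => // l u lmu ud.
by apply: dP; split; rewrite -ball_normE/= ?sub0r ?normrN// distrC.
Qed.

(** Along the segment from v to u the partial derivative stays within e of its value at (mu, 0), so
    the remainder is Lipschitz with constant e, uniformly in l. *)
Lemma strict_derivative_u (mu : R) (e : R) : 0 < e ->
  (\forall p \near (mu, 0 : X), differentiable (fun u => F (p.1, u)) p.2 /\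
     forall v, `|D_u F p v - D_u F (mu, 0) v| <= e * `|v|) ->
  exists2 d : R, 0 < d & forall l u v, `|l - mu| < d -> `|u| < d -> `|v| < d ->
    `|F (l, u) - F (l, v) - D_u F (mu, 0) (u - v)| <= e * `|u - v|.
Proof.
move=> e0 /near_pair0P[d d0 dP]; exists d => // l u v lmu ud vd.
have seg (t : R) (t01 : 0 <= t <= 1) := segment_norm_lt t01 ud vd.
apply: (diff_mean_value (f := fun u => F (l, u))) => t /seg td.
  by have [] := dP _ _ lmu td.
by have [_] := dP _ _ lmu td; exact.
Qed.

(** The mean value inequality is used twice: in u, to compare [D_l F] with the linear map
    [D_lu F (mu, 0)], and then in the parameter, to integrate that bound from m to l. *)
Lemma strict_derivative_lu (mu : R) (e : R) : 0 < e ->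
  (\forall l \near mu, F (l, 0) = 0) ->
  (\forall p \near (mu, 0 : X), [/\ derivable (fun t => F (t, p.2)) p.1 1,
     differentiable (fun u => D_l F (p.1, u)) p.2 &
     forall v, `|D_lu F p v - D_lu F (mu, 0) v| <= e * `|v|]) ->
  exists2 d : R, 0 < d & forall l m u, `|l - mu| < d -> `|m - mu| < d -> `|u| < d ->
    `|F (l, u) - F (m, u) - (l - m) *: D_lu F (mu, 0) u| <= e * `|u| * `|l - m|.
Proof.
move=> e0 /nbhs_ballP[d1 /= d10 F0] /near_pair0P[d2 d20 dP].
pose d := Num.min d1 d2; have d0 : 0 < d by rewrite lt_min d10.
have ltd x : x < d -> x < d1 /\ x < d2 by rewrite lt_min => /andP.
exists d => // l m u ld md /ltd[_ ud].
have Dl x : `|x - mu| < d -> `|D_l F (x, u) - D_lu F (mu, 0) u| <= e * `|u|.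
  move=> /ltd[x1 x2].
  (* [F] vanishes on the trivial branch near (x, 0), hence so does its derivative in the parameter;
     the comparison in u starts from 0. *)
  have D0 : D_l F (x, 0) = 0.
    rewrite /D_l /= derive1E -[RHS](derive_cst (0 : Y) x 1).
    apply: near_eq_derive; apply/nbhs_ballP.
    exists (d1 - `|x - mu|) => [/=|y]; first by rewrite subr_gt0.
    rewrite -ball_normE/= => xy; apply: F0; rewrite -ball_normE/=.
    have -> : mu - y = (x - y) - (x - mu) by lra.
    by rewrite (le_lt_trans (ler_normB _ _))//; lra.
  rewrite -[D_l F (x, u)]subr0 -D0.
  have seg (t : R) : 0 <= t <= 1 -> `|0 + t *: (u - 0)| < d2.
    move=> /andP[t0 t1]; rewrite add0r subr0 normrZ ger0_norm//.
    by rewrite (le_lt_trans _ ud)// ler_piMl.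
  apply: (diff_mean_value (f := fun u => D_l F (x, u))) => t /seg td.
    by have [] := dP _ _ x2 td.
  by rewrite subr0 in td *; have [_ _] := dP _ _ x2 td; exact.
have seg (t : R) : 0 <= t <= 1 -> `|m + t *: (l - m) - mu| < d.
  move=> t01; have := segment_norm_lt t01 ld md.
  by rewrite [m - mu + _]addrAC opprB addrA subrK.
apply: (@diff_mean_value R R Y (fun t => F (t, u)) m l) => t /seg td.
  by apply/derivable1_diffP; have [_ /dP/(_ ud)[]] := ltd _ td.
rewrite deriv1E; last by have [_ /dP/(_ ud)[]] := ltd _ td.
by rewrite -scalerBr normrZ mulrC ler_wpM2r// Dl.
Qed.

End PartialDerivativeLemmas.

(** * Blow-up and bifurcation *)

Lemma isometry_continuous (R : realType) (V W : normedModType R)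
    (f : {linear V -> W}) : (forall v, `|f v| = `|v|) -> continuous f.
Proof.
move=> fn x; apply/cvgrPdist_lt => e e0; near=> y.
by rewrite -linearB fn; near: y; exact: cvgr_dist_lt.
Unshelve. all: by end_near. Qed.

(** [T] is corestricted to the closed subspace, itself a Banach space, where the open mapping
    theorem applies. *)
Lemma bounded_preimage_closed (R : realType) (E Y : completeNormedModType R)
    (S : submodClosed Y) (Sc : closed [set` S]) (T : {linear E -> Y}) :
  continuous T -> (forall x, T x \in S) ->
  (forall y, y \in S -> exists x, T x = y) ->
  exists2 M : R, 0 < M &
    forall y, y \in S -> exists2 x, T x = y & `|x| <= M * `|y|.
Proof.
move=> Tc TS Tsurj.
pose t x : closed_subspace Sc := exist _ (T x) (TS x).
have tlin : linear t by move=> a x y; apply: val_inj; rewrite /= linearP.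
pose t' : {linear E -> closed_subspace Sc} :=
  HB.pack t (GRing.isLinear.Build _ _ _ _ t tlin).
have tc : continuous t'.
  move=> x; apply/cvgrPdist_lt => e e0.
  by have /cvgrPdist_lt/(_ e e0) := Tc x.
have tsurj y : exists x, t' x = y.
  by have [x xy] := Tsurj _ (valP y); exists x; apply: val_inj.
have [M M0 MP] := bounded_preimage tc tsurj.
exists M => // y Sy; have [x xy xM] := MP (exist _ y Sy).
by exists x => //; rewrite -[RHS]/(val (exist _ y Sy : closed_subspace Sc)) -xy.
Qed.

Section Blowup.
Context (R : realType) (X Y V : normedModType R) (j : {linear V -> X}).
Context (w : X) (F : R * X -> Y) (A B : {linear X -> Y}) (mu : R).

(* Meaningful for [s != 0] only: [blowup 0] is the zero map. *)
Definition blowup (s : R) (p : R * V) : Y := s^-1 *: F (p.1, s *: (w + j p.2)).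

Definition blowup_diff (p : R * V) : Y := p.1 *: B w + A (j p.2).

Fact blowup_diff_linear : linear blowup_diff.
Proof.
move=> a [l x] [m y]; rewrite /blowup_diff/= linearP linearP.
by rewrite scalerDr scalerDl scalerA addrACA.
Qed.

HB.instance Definition _ :=
  GRing.isLinear.Build R (R * V)%type Y _ blowup_diff blowup_diff_linear.

(** The increment splits in two: x changes at fixed l, with error e |x - y| by the first estimate;
    then l changes at fixed y, with error e (|w| + 1) |l - m| by the second. Replacing B (w + j y)
    by B w costs the remaining b r |l - m|. *)
Lemma blowup_lipschitz (d e b r s : R) (p q : R * V) :
  (forall v, `|j v| = `|v|) ->
  (forall l u v, `|l - mu| < d -> `|u| < d -> `|v| < d ->
    `|F (l, u) - F (l, v) - A (u - v)| <= e * `|u - v|) ->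
  (forall l m u, `|l - mu| < d -> `|m - mu| < d -> `|u| < d ->
    `|F (l, u) - F (m, u) - (l - m) *: B u| <= e * `|u| * `|l - m|) ->
  (forall u, `|B u| <= b * `|u|) -> 0 <= e -> 0 <= b ->
  r <= 1 -> r < d -> s != 0 -> `|s| * (`|w| + 1) < d ->
  `|p - (mu, 0)| <= r -> `|q - (mu, 0)| <= r ->
  `|blowup s p - blowup s q - blowup_diff (p - q)|
    <= (e * (`|w| + 2) + b * r) * `|p - q|.
Proof.
case: p q => [l x] [m y] jn E1 E2 Bb e0 b0 r1 rd s0 sd.
rewrite !prod_normE/= !subr0 !ge_max => /andP[lr xr] /andP[mr yr].
have ns : 0 < `|s| by rewrite normr_gt0.
have small v : `|v| <= r -> `|s *: (w + j v)| < d.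
  move=> vr; rewrite normrZ (le_lt_trans _ sd)// ler_wpM2l//.
  by rewrite (le_trans (ler_normD _ _))// lerD2l jn (le_trans vr).
have ld : `|l - mu| < d by exact: le_lt_trans rd.
have md : `|m - mu| < d by exact: le_lt_trans rd.
have := E1 l _ _ ld (small _ xr) (small _ yr).
set f1 := F (l, s *: (w + j x)); set f2 := F (l, s *: (w + j y)).
rewrite -scalerBr normrZ mulrCA linearZ/= [w + _]addrC addrKA -linearB => H1.
have := E2 l m _ ld md (small _ yr).
rewrite -/f2; set f3 := F (m, s *: (w + j y)) => H2.
have -> : blowup s (l, x) - blowup s (m, y) - blowup_diff (l - m, x - y) =
  s^-1 *: (f1 - f2 - s *: A (j (x - y))) +
  (s^-1 *: (f2 - f3 - (l - m) *: B (s *: (w + j y))) + (l - m) *: B (j y)).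
  have -> : s^-1 *: (f1 - f2 - s *: A (j (x - y))) =
      s^-1 *: f1 - A (j (x - y)) - s^-1 *: f2.
    by rewrite addrAC !scalerBr scalerA mulVf// scale1r.
  have -> : s^-1 *: (f2 - f3 - (l - m) *: B (s *: (w + j y))) =
      s^-1 *: f2 + (- s^-1 *: f3 - (l - m) *: B w) - (l - m) *: B (j y).
    have -> : (l - m) *: B (s *: (w + j y)) = s *: ((l - m) *: (B w + B (j y))).
      by rewrite linearZ linearD /= !scalerA mulrC.
    by rewrite !scalerBr [s^-1 *: (s *: _)]scalerA mulVf// scale1r scalerDr opprD
      !addrA scaleNr.
  rewrite subrK addrA subrK scaleNr -/f1 /blowup_diff/= opprD -!addrA; congr (_ + _).
  by rewrite [RHS]addrC -addrA.
rewrite (le_trans (ler_normD _ _))//.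
have n1 : `|x - y| <= Num.max `|l - m| `|x - y| by rewrite le_max lexx orbT.
have n2 : `|l - m| <= Num.max `|l - m| `|x - y| by rewrite le_max lexx.
set n := Num.max _ _ in n1 n2 *.
have K1 : `|s^-1 *: (f1 - f2 - s *: A (j (x - y)))| <= e * n.
  rewrite normrZ normfV ler_pdivrMl// (le_trans H1)//.
  by rewrite jn ler_wpM2l// ler_wpM2l.
have K2 : `|s^-1 *: (f2 - f3 - (l - m) *: B (s *: (w + j y)))| <= e * (`|w| + 1) * n.
  rewrite normrZ normfV ler_pdivrMl// (le_trans H2)//.
  rewrite normrZ !mulrA [e * _]mulrC -!mulrA ler_wpM2l// ler_wpM2l//.
  rewrite ler_pM//  (le_trans (ler_normD _ _))// lerD2l jn (le_trans yr)//.
have K3 : `|(l - m) *: B (j y)| <= b * r * n.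
  rewrite normrZ mulrC ler_pM// (le_trans (Bb _))// jn ler_wpM2l//.
have := ler_normD (s^-1 *: (f2 - f3 - (l - m) *: B (s *: (w + j y))))
  ((l - m) *: B (j y)).
nra.
Qed.

(** Joint continuity serves twice: in p for the limit of the Newton iterates, in s for the
    continuity of the branch. *)
Lemma blowup_continuous (s : R) (p : R * V) : continuous j -> s != 0 ->
  {for (p.1, s *: (w + j p.2)), continuous F} ->
  {for (s, p), continuous (fun q : R * (R * V) => blowup q.1 q.2)}.
Proof.
move=> jc s0 Fc.
have c1 : q.1 @[q --> (s, p)] --> s by exact: cvg_fst.
have c2 : q.2 @[q --> (s, p)] --> p by exact: cvg_snd.
have c21 : q.2.1 @[q --> (s, p)] --> p.1.
  by apply: (cvg_comp _ _ c2); exact: cvg_fst.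
have c22 : j q.2.2 @[q --> (s, p)] --> j p.2.
  by apply: (cvg_comp _ _ (cvg_comp _ _ c2 _)); [exact: cvg_snd|exact: jc].
have c3 : q.1 *: (w + j q.2.2) @[q --> (s, p)] --> s *: (w + j p.2).
  by apply: cvgZ => //; apply: cvgD => //; exact: cvg_cst.
have c4 : F (q.2.1, q.1 *: (w + j q.2.2)) @[q --> (s, p)]
    --> F (p.1, s *: (w + j p.2)).
  exact: cvg_comp (cvg_pair c21 c3) Fc.
by apply: cvgZ c4; exact: cvgV.
Qed.

End Blowup.

(** Here [X] stands for span w + X0 and [j] for the inclusion of X0; [S] is the target Y~ and [D]
    the domain in which the solutions must remain. Differentiability enters through the two
    remainder estimates, and the last three conditions say that T is a bijection of [R * V] onto
    [S]. *)
Theorem bifurcation (R : realType) (X : normedModType R)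
    (Y V : completeNormedModType R) (j : {linear V -> X}) (w : X)
    (F : R * X -> Y) (A B : {linear X -> Y}) (mu : R)
    (S : submodClosed Y) (D : set (R * X)) :
  closed [set` S] ->
  (forall v, `|j v| = `|v|) -> w != 0 ->
  (forall u, exists s v, u = s *: w + j v) ->
  (\forall p \near (mu, 0 : X), [/\ D p, F p \in S & {for p, continuous F}]) ->
  (\forall l \near mu, F (l, 0) = 0) ->
  (forall e : R, 0 < e -> exists2 d : R, 0 < d &
    forall l u v, `|l - mu| < d -> `|u| < d -> `|v| < d ->
    `|F (l, u) - F (l, v) - A (u - v)| <= e * `|u - v|) ->
  (forall e : R, 0 < e -> exists2 d : R, 0 < d &
    forall l m u, `|l - mu| < d -> `|m - mu| < d -> `|u| < d ->
    `|F (l, u) - F (m, u) - (l - m) *: B u| <= e * `|u| * `|l - m|) ->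
  continuous A -> continuous B -> A w = 0 ->
  (forall a v, a *: B w + A (j v) \in S) ->
  (forall a v, a *: B w + A (j v) = 0 -> a = 0 /\ v = 0) ->
  (forall y, y \in S -> exists a v, y = a *: B w + A (j v)) ->
  exists (d : R) (lam : R -> R) (psi : R -> V),
    let u s := s *: w + s *: j (psi s) in
    [/\ 0 < d,
        forall s, `|s| < d -> {for s, continuous lam} /\ {for s, continuous psi},
        lam 0 = mu /\ psi 0 = 0,
        forall s, `|s| < d -> D (lam s, u s) /\ F (lam s, u s) = 0
      & \forall p \near (mu, 0 : X), F p = 0 <->
          p.2 = 0 \/ exists2 s, `|s| < d & p = (lam s, u s)].
Proof.
move=> Sc jn w0 jw /near_pair0P[d1 d10 d1P] /nbhs_ballP[d2 /= d20 d2P].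
move=> E1 E2 Ac Bc Aw TS Tinj Tsurj.
pose T : {linear (R * V)%type -> Y} := blowup_diff j w A B.
have nw : 0 < `|w| by rewrite normr_gt0.
have jc := isometry_continuous jn.
have jc2 : continuous (fun q : R * V => j q.2).
  by move=> q; apply: (@continuous_comp _ _ _ snd j); [exact: cvg_snd|exact: jc].
have Ajc : continuous (fun q : R * V => A (j q.2)).
  by move=> q; apply: (@continuous_comp _ _ _ (fun q => j q.2) A);
    [exact: jc2|exact: Ac].
have Tc : continuous T.
  move=> p; apply: cvgD; last exact: Ajc.
  by apply: cvgZ; [exact: cvg_fst|exact: cvg_cst].
have [M M0 MP] : exists2 M : R, 0 < M &
    forall y, y \in S -> exists2 x, T x = y & `|x| <= M * `|y|.
  apply: (bounded_preimage_closed Sc Tc) => [[a v]|y Sy]; first exact: TS.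
  by have [a [v ->]] := Tsurj y Sy; exists (a, v).
(* Injectivity identifies [p] with the controlled preimage of [T p], so [T] is bounded below. *)
have TM p : `|p| <= M * `|T p|.
  have [q Tq qM] : exists2 q, T q = T p & `|q| <= M * `|T p|.
    by apply: MP; case: p => a v; exact: TS.
  suff -> : p = q by rewrite -Tq in qM *.
  apply/eqP; rewrite -subr_eq0.
  have : T (p - q) = 0 by rewrite linearB Tq subrr.
  by case: (p - q) => a v /(Tinj a v)[-> ->].
have [b b0 Bb] := linear_lipschitz Bc.
pose G := blowup j w F; pose p0 : R * V := (mu, 0).
(* As M k = 1/2, a perturbation of [T] with Lipschitz constant k can be absorbed. The choices of [e]
   and [r] below make each of the two terms of that constant at most k / 2. *)
pose k := (2 * M)^-1.
have k0 : 0 < k by rewrite invr_gt0 mulr_gt0.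
pose e := k / (2 * (`|w| + 2)).
have e0 : 0 < e by rewrite divr_gt0// mulr_gt0// addr_gt0.
have [d3 d30 d3P] := E1 e e0.
have [d4 d40 d4P] := E2 e e0.
pose d := Num.min (Num.min d1 d2) (Num.min d3 d4).
have d0 : 0 < d by rewrite !lt_min d10 d20 d30.
have ltd x : x < d -> [/\ x < d1, x < d2, x < d3 & x < d4].
  by rewrite !lt_min => /andP[/andP[-> ->] /andP[-> ->]].
have F0 l : `|l - mu| < d -> F (l, 0) = 0.
  by move=> /ltd[_ ? _ _]; apply: d2P; rewrite -ball_normE/= distrC.
pose r := Num.min (Num.min 1 (d / 2)) (k / (2 * b)).
have r0 : 0 < r by rewrite !lt_min ltr01 !divr_gt0// mulr_gt0.
have [r1 rd rb] : [/\ r <= 1, r < d & b * r <= k / 2].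
  have [rl1 rld rlb] : [/\ r <= 1, r <= d / 2 & r <= k / (2 * b)].
    by rewrite !ge_min !lexx !orbT.
  split; [by []|by lra|].
  by rewrite mulrC -ler_pdivlMr// (le_trans rlb)// invfM mulrA.
(* As r <= 1, for |s| < s1 the point s (w + j x) has norm below d whenever |x| <= r. *)
pose s1 := d / (`|w| + 1).
have s10 : 0 < s1 by rewrite divr_gt0// addr_gt0.
have s1P s : `|s| < s1 -> `|s| * (`|w| + 1) < d by rewrite ltr_pdivlMr// addr_gt0.
have lip s p q : s != 0 -> `|s| < s1 -> `|p - p0| <= r -> `|q - p0| <= r ->
    `|G s p - G s q - T (p - q)| <= k * `|p - q|.
  move=> sn0 /s1P sd pr qr.
  have := @blowup_lipschitz _ _ _ _ j w F A B mu d e b r s p q jn.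
  move=> /(_ _ _ Bb (ltW e0) (ltW b0) r1 rd sn0 sd pr qr) H.
  apply: le_trans (H _ _) _.
  - by move=> l u v /ltd[_ _ ? _] /ltd[_ _ ? _] /ltd[_ _ ? _]; exact: d3P.
  - by move=> l m u /ltd[_ _ _ ?] /ltd[_ _ _ ?] /ltd[_ _ _ ?]; exact: d4P.
  rewrite ler_wpM2r//; suff : e * (`|w| + 2) = k / 2 by move=> ->; lra.
  by rewrite /e; field; rewrite gt_eqF// addr_gt0.
(* |p - q| <= M |T (p - q)|, and the error term M k |p - q| is half of the left side. *)
have expand s p q : s != 0 -> `|s| < s1 -> `|p - p0| <= r -> `|q - p0| <= r ->
    `|p - q| <= 2 * M * `|G s p - G s q|.
  move=> sn0 ss1 pr qr; have H := lip s p q sn0 ss1 pr qr.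
  have H2 : `|T (p - q)| <= `|G s p - G s q| + k * `|p - q|.
    rewrite -(subKr (G s p - G s q) (T (p - q))) (le_trans (ler_normB _ _))//.
    by rewrite lerD2l.
  have H3 := TM (p - q).
  have : M * (k * `|p - q|) = `|p - q| / 2 by rewrite /k; field; rewrite gt_eqF.
  by nra.
have inD s p : `|s| < s1 -> `|p - p0| <= r ->
    [/\ D (p.1, s *: (w + j p.2)), F (p.1, s *: (w + j p.2)) \in S
      & {for (p.1, s *: (w + j p.2)), continuous F}].
  move=> /s1P sd; rewrite prod_normE/= ge_max subr0 => /andP[lr xr].
  have [? _ _ _] := ltd _ (le_lt_trans lr rd).
  apply: d1P => //; suff /ltd[] : `|s *: (w + j p.2)| < d by [].
  rewrite normrZ (le_lt_trans _ sd)// ler_wpM2l//.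
  by rewrite (le_trans (ler_normD _ _))// lerD2l jn (le_trans xr).
(* [F] vanishes at (mu, 0) and [A w = 0], so F (mu, s w) = o(s). *)
have G0 e' : 0 < e' -> exists2 d' : R, 0 < d' & forall s, s != 0 -> `|s| < d' ->
    `|G s p0| <= e'.
  move=> e'0; have e'w : 0 < e' / `|w| by rewrite divr_gt0.
  have [d' d'0 d'P] := E1 _ e'w.
  exists (d' / `|w|) => [|s sn0 sd]; first by rewrite divr_gt0.
  have := d'P mu (s *: w) 0; rewrite subrr !normr0 subr0 normrZ -ltr_pdivlMr//.
  move=> /(_ d'0 sd d'0); rewrite linearZ/= Aw scaler0 F0 ?subrr ?normr0// !subr0.
  rewrite /G /blowup/= raddf0 addr0 normrZ normfV ler_pdivrMl ?normr_gt0//.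
  move=> /le_trans; apply.
  by rewrite mulrCA mulfVK ?gt_eqF// mulrC.
have [|s2 s20 s2P] := G0 (r / (2 * M)).
  by rewrite divr_gt0// mulr_gt0.
pose dl := Num.min s1 s2.
have dl0 : 0 < dl by rewrite lt_min s10.
have ltdl x : x < dl -> x < s1 /\ x < s2 by rewrite lt_min => /andP.
have zero s : s != 0 -> `|s| < dl ->
    exists2 p, `|p - p0| <= 2 * M * `|G s p0| & G s p = 0.
  move=> sn0 /ltdl[ss1 ss2].
  have GS p : `|p - p0| <= r -> G s p \in S.
    by move=> pr; have [_ ? _] := inD s p ss1 pr; rewrite rpredZ.
  (* The value 0 outside [S] only makes [g] total; the residuals in the ball lie in [S] by [GS]. *)
  have Pex y : exists x, y \in S -> T x = y /\ `|x| <= M * `|y|.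
    case: (boolP (y \in S)) => [/MP[x ? ?]|_]; last by exists 0.
    by exists x.
  have [g gP] := choice Pex.
  (* A Newton step with a fixed right inverse of [T]: the new residual is the nonlinear error, at
     most k M |G s p| = |G s p| / 2. *)
  apply: (@zero_of_halving _ _ _ (G s) (fun p => p - g (G s p)) p0 M r)
    => [||p pr|p pr].
  - exact: ltW.
  - by rewrite mulrC -ler_pdivlMr ?mulr_gt0// s2P.
  - have [_ _ Fc] := inD s p ss1 pr.
    have sp : (s, q) @[q --> p] --> (s, p).
      exact: (cvg_pair (cvg_cst s) cvg_id).
    exact: cvg_comp sp (blowup_continuous jc sn0 Fc).
  - have [Tg gM] := gP _ (GS p pr).
    have Ng : p - g (G s p) - p = - g (G s p) by rewrite addrAC subrr add0r.
    split=> [|Npr]; first by rewrite Ng normrN.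
    have := lip s _ p sn0 ss1 Npr pr.
    rewrite Ng linearN Tg opprK subrK normrN => /le_trans; apply.
    have : k * (M * `|G s p|) = `|G s p| / 2 by rewrite /k; field; rewrite gt_eqF.
    by move=> <-; rewrite ler_pM2l.
(* At s = 0, where [blowup] is the zero map, the branch is given its limit value [p0]; for |s| >=
   dl, [p0] is a default. *)
have Pex s : exists p, [/\ s = 0 -> p = p0,
    s != 0 -> `|s| < dl -> `|p - p0| <= 2 * M * `|G s p0|
    & s != 0 -> `|s| < dl -> G s p = 0].
  have [->|sn0] := eqVneq s 0; first by exists p0; split; rewrite // eqxx.
  have [sdl|sdl] := ltP `|s| dl.
    have [p ? ?] := zero s sn0 sdl.
    by exists p; split => [s0| |] //; move: sn0; rewrite s0 eqxx.
  by exists p0; split => [s0|_|_]; rewrite ?ltNge ?sdl//.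
have [P PP] := choice Pex.
have P0 : P 0 = p0 by have [->] := PP 0.
have Pr s : `|s| < dl -> `|P s - p0| <= r.
  have [->|sn0 sdl] := eqVneq s 0; first by move=> _; rewrite P0 subrr normr0 ltW.
  have [_ /(_ sn0 sdl) /le_trans + _] := PP s; apply.
  have [_ ss2] := ltdl _ sdl.
  by rewrite mulrC -ler_pdivlMr ?mulr_gt0// s2P.
(* At 0 the branch is controlled by the initial residual. Elsewhere [expand] at t gives |P s - P t|
   <= 2 M |G t (P s)|, and G t (P s) tends to G s (P s) = 0. *)
have Pc s : `|s| < dl -> {for s, continuous P}.
  move=> sdl; apply/cvgrPdist_le => e' e'0.
  have e'M : 0 < e' / (2 * M) by rewrite divr_gt0// mulr_gt0.
  have [s0|sn0] := eqVneq s 0.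
    have [d' d'0 d'P] := G0 _ e'M; rewrite s0 P0.
    near=> t; have [->|tn0] := eqVneq t 0; first by rewrite P0 subrr normr0 ltW.
    have : `|0 - t| < Num.min d' dl.
      by near: t; apply: cvgr_dist_lt; [exact: cvg_id|rewrite lt_min d'0].
    rewrite sub0r normrN lt_min => /andP[td' tdl].
    have [_ /(_ tn0 tdl) H _] := PP t; rewrite distrC (le_trans H)//.
    by rewrite mulrC -ler_pdivlMr ?mulr_gt0// d'P.
  have [ss1 ss2] := ltdl _ sdl.
  have Hc : G t (P s) @[t --> s] --> G s (P s).
    have [_ _ Fc] := inD s (P s) ss1 (Pr s sdl).
    have sp : (t, P s) @[t --> s] --> (s, P s).
      exact: (cvg_pair cvg_id (cvg_cst (P s))).
    exact: cvg_comp sp (blowup_continuous jc sn0 Fc).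
  have [_ _ /(_ sn0 sdl) GP0] := PP s; rewrite GP0 in Hc.
  near=> t.
  have : `|s - t| < Num.min `|s| (dl - `|s|).
    by near: t; apply: cvgr_dist_lt; [exact: cvg_id|
      rewrite lt_min normr_gt0 sn0 subr_gt0].
  rewrite lt_min => /andP[st tdl].
  have tn0 : t != 0 by apply: contraTneq st => ->; rewrite subr0 ltxx.
  have {}tdl : `|t| < dl.
    have := ler_normB s (s - t); rewrite subKr; lra.
  have [ts1 _] := ltdl _ tdl.
  rewrite (le_trans (expand t _ _ tn0 ts1 (Pr s sdl) (Pr t tdl)))//.
  have [_ _ /(_ tn0 tdl) ->] := PP t; rewrite subr0.
  rewrite mulrC -ler_pdivlMr ?mulr_gt0// -normrN -sub0r.
  by near: t; move: Hc => /cvgrPdist_le; apply.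
pose u s := s *: w + s *: j (P s).2.
have uE s : u s = s *: (w + j (P s).2) by rewrite scalerDr.
have Fu s : `|s| < dl -> F ((P s).1, u s) = 0.
  have [->|sn0] := eqVneq s 0.
    by move=> _; rewrite uE scale0r P0 F0// subrr normr0.
  move=> sdl; have [_ _ /(_ sn0 sdl)/eqP] := PP s.
  by rewrite /G /blowup scaler_eq0 invr_eq0 (negbTE sn0)/= -uE => /eqP.
exists dl, (fun s => (P s).1), (fun s => (P s).2); split=> /=.
- exact: dl0.
- move=> s sdl; split.
    by apply: (@continuous_comp _ _ _ P fst); [exact: Pc|exact: cvg_fst].
  by apply: (@continuous_comp _ _ _ P snd); [exact: Pc|exact: cvg_snd].
- by rewrite P0.
- move=> s sdl; split; last exact: Fu.
  have [ss1 _] := ltdl _ sdl.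
  by have [] := inD s (P s) ss1 (Pr s sdl); rewrite -uE.
(* The bound 1/2 lets |y| be absorbed when |v| is replaced by |s| |w|; the other gives h |w| <= r,
   so that s^-1 y lies in the ball of radius r. *)
pose h := Num.min 2^-1 (r / (1 + `|w|)).
have h0 : 0 < h by rewrite lt_min invr_gt0 ltr0n divr_gt0// addr_gt0.
have [h2 hr] : h <= 2^-1 /\ h <= r / (1 + `|w|) by rewrite !ge_min !lexx orbT.
have hwr : h * `|w| <= r.
  move: hr; rewrite ler_pdivlMr ?addr_gt0//; nra.
have [|d5 d50 d5P] := E1 (h / (2 * M)); first by rewrite divr_gt0// mulr_gt0.
(* The last entry forces |s| < dl, since |s| |w| <= |v| + |y| <= 2 |v|. *)
pose d6 := Num.min (Num.min d d5) (Num.min r (dl * `|w| / 2)).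
have d60 : 0 < d6 by rewrite lt_min lt_min d0 d50 lt_min r0 divr_gt0// mulr_gt0.
apply/nbhs_ballP; exists d6 => // -[l v] [/=].
rewrite -!ball_normE/= sub0r normrN distrC /d6.
rewrite 2![_ < Num.min (Num.min d d5) _]lt_min 2![_ < Num.min d d5]lt_min
  2![_ < Num.min r _]lt_min.
move=> /andP[/andP[ld ld5] /andP[lr _]] /andP[/andP[vd vd5] /andP[_ vdl]].
split=> [Fv0|]; last first.
  by case=> [->|[s sdl [-> ->]]]; [exact: F0|exact: Fu].
have [s [y vE]] := jw v.
(* A zero off the trivial branch is nearly tangent to w, so that its rescaling
   lies in the ball where the zero of [G s] is unique. *)
have yb : `|y| <= h / 2 * `|v|.
  have := d5P l v 0 ld5 vd5; rewrite normr0 => /(_ d50).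
  rewrite Fv0 F0// !subr0 sub0r normrN vE linearD linearZ/= Aw scaler0 add0r.
  have := TM (0, y); rewrite prod_normE/= normr0 max_r// /blowup_diff/= scale0r add0r.
  set n := `|s *: w + _| => H1 H2; rewrite (le_trans H1)//
    -ler_pdivlMl// (le_trans H2)//.
  suff -> : h / (2 * M) * n = M^-1 * (h / 2 * n) by [].
  by field; rewrite gt_eqF.
have vle : `|v| <= `|s| * `|w| + `|y|.
  by rewrite vE (le_trans (ler_normD _ _))// normrZ jn.
have swle : `|s| * `|w| <= `|v| + `|y|.
  by rewrite -normrZ -(jn y) -(addrK (j y) (s *: w)) -vE ler_normB.
have ysw : `|y| <= h * (`|s| * `|w|).
  have : 0 <= `|s| * `|w| by rewrite mulr_ge0.
  have : 0 <= `|y| by [].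
  by nra.
have [s0|sn0] := eqVneq s 0.
  left; rewrite vE s0 scale0r add0r; apply/eqP; rewrite -normr_eq0 jn.
  by move: ysw; rewrite s0 normr0 mul0r mulr0 normr_le0 normr_eq0.
right; have ns : 0 < `|s| by rewrite normr_gt0.
have sdl : `|s| < dl.
  have : 0 <= `|s| * `|w| by rewrite mulr_ge0.
  rewrite -(ltr_pM2r nw); nra.
exists s => //.
have [ss1 _] := ltdl _ sdl.
pose q : R * V := (l, s^-1 *: y).
have qr : `|q - p0| <= r.
  rewrite prod_normE/= subr0 ge_max (ltW lr)/= normrZ normfV ler_pdivrMl//.
  by rewrite (le_trans ysw)// mulrCA ler_pM2l.
have vE' : v = s *: (w + j q.2).
  by rewrite vE scalerDr /= -linearZ scalerA divff// scale1r.
(* [q] and [P s] are zeros of [G s] in the same ball, so [expand] makes them equal. *)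
have := expand s q (P s) sn0 ss1 qr (Pr s sdl).
have [_ _ /(_ sn0 sdl) ->] := PP s.
rewrite {1}/G /blowup -vE' Fv0 scaler0 subrr normr0 mulr0 normr_le0.
rewrite subr_eq0 => /eqP qP.
by rewrite -scalerDr -qP -vE'.
Unshelve. all: by end_near.
Qed.

(** * Closed subspaces, codimension, and restriction to a subspace *)

(** Difference quotients with small increments lie in [S], and [S] is closed. This serves to place
    the mixed derivative in Y~. *)
Lemma derive_closed_subspace (R : realType) (V W : normedModType R)
    (S : submodClosed W) (Sc : closed [set` S]) (f : V -> W) (x v : V) :
  derivable f x v -> (\forall y \near x, f y \in S) -> 'D_v f x \in S.
Proof.
move=> df fS; apply: (closed_cvg _ Sc _ _ df).
have fxS := nbhs_singleton fS.
have : \forall h \near (0 : R), f (h *: v + x) \in S.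
  have hc : h *: v + x @[h --> (0 : R)] --> x.
    rewrite -[X in _ --> X]add0r -(scale0r v); apply: cvgD; last exact: cvg_cst.
    by apply: cvgZ; [exact: cvg_id|exact: cvg_cst].
  exact: hc fS.
move=> H; near=> h; rewrite /= rpredZ//.
apply: rpredD; last by rewrite -[- f x]scaleN1r rpredZ.
near: h.
exact: cvg_within H.
Unshelve. all: by end_near. Qed.

Section LineDimension.
Context (R : realType) (V : lmodType R).

(** Two basis vectors a0 g and a1 g satisfy a1 (a0 g) - a0 (a1 g) = 0; independence gives a0 = 0, so
    the first of them vanishes, a contradiction. *)
Lemma has_dim_line (K : set V) (g : V) (n : nat) :
  g != 0 -> (forall x, K x <-> exists a, x = a *: g) -> has_dim K n -> n = 1%N.
Proof.
move=> g0 KE [e [_ Ke einj espan]].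
case: n e Ke einj espan => [|[|n]]// e Ke einj espan.
  have [|c] := espan g; first by apply/KE; exists 1; rewrite scale1r.
  by rewrite big_ord0 subr0 => /eqP; rewrite (negbTE g0).
have [a0 e0] := (KE _).1 (Ke ord0); have [a1 e1] := (KE _).1 (Ke ord_max).
have pick k (f : 'I_n.+2 -> V) : \sum_i (i == k)%:R *: f i = f k.
  rewrite (bigD1 k)//= eqxx scale1r big1 ?addr0// => i /negbTE ->.
  exact: scale0r.
pose c (i : 'I_n.+2) : R := (i == ord0)%:R * a1 - (i == ord_max)%:R * a0.
have c0 : \sum_i c i *: e i = 0.
  under eq_bigr do rewrite scalerBl -!scalerA.
  by rewrite sumrB !pick e0 e1 !scalerA mulrC subrr.
have := einj c c0 ord_max; rewrite /c eqxx mul0r sub0r mul1r => /eqP.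
rewrite oppr_eq0 => /eqP a00.
have := einj (fun i => (i == ord0)%:R) _ ord0.
rewrite pick e0 a00 scale0r eqxx => /(_ erefl)/eqP.
by rewrite oner_eq0.
Qed.

(** The class of [z] is a nonzero vector of a line, hence generates it; the coefficient is the
    quotient of the coordinates of [y] and [z]. *)
Lemma codim1_span (N A : set V) (z : V) :
  (forall a x y, N x -> N y -> N (a *: x + y)) ->
  has_codim_in A N 1 -> A z -> ~ N z ->
  forall y, A y -> exists a, N (y - a *: z).
Proof.
move=> Nlin [e [NA _ _ espan]] Az Nz y Ay.
have [cz] := espan z Az; have [cy] := espan y Ay.
rewrite !big_ord1 => Ny Nz'.
have cz0 : cz ord0 != 0.
  by apply: contra_notN Nz => /eqP c0; rewrite c0 scale0r subr0 in Nz'.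
exists (cy ord0 / cz ord0).
have -> : y - (cy ord0 / cz ord0) *: z =
    - (cy ord0 / cz ord0) *: (z - cz ord0 *: e ord0) + (y - cy ord0 *: e ord0).
  rewrite scalerBr !scaleNr scalerA divfK// opprK.
  by rewrite [RHS]addrC addrACA addNr addr0.
exact: Nlin.
Qed.

End LineDimension.

Section Restriction.
Context (R : realType) (X Y : normedModType R) (S : submodClosed X).
Context (F : R * X -> Y).

Lemma near_subspace (mu : R) (P : R * X -> Prop) :
  (\forall p \near (mu, 0 : X), P p) ->
  \forall p \near (mu, 0 : subspace_type S), P (p.1, val p.2).
Proof.
move=> /near_pair0P[d d0 dP]; apply/nbhs_ballP; exists d => // -[l u] [/=].
by rewrite -!ball_normE/= sub0r normrN distrC => ? ?; exact: dP.
Qed.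

(** With the inherited norm, balls of the subspace are traces of ambient balls; this carries the
    local description of the zeros back to [X]. *)
Lemma near_subspaceW (mu : R) (P : R * subspace_type S -> Prop) :
  (\forall p \near (mu, 0 : subspace_type S), P p) ->
  \forall p \near (mu, 0 : X), forall Sp : p.2 \in S, P (p.1, exist _ p.2 Sp).
Proof.
move=> /near_pair0P[d d0 dP]; apply/nbhs_ballP; exists d => // -[l u] [/=].
by rewrite -!ball_normE/= sub0r normrN distrC => ? ? Sp; exact: dP.
Qed.

Lemma differentiable_restr (p : R * subspace_type S) :
  differentiable F (p.1, val p.2) ->
  [/\ differentiable (fun u => restr F (p.1, u)) p.2,
     forall v, D_u (restr F) p v = 'd F (p.1, val p.2) (0, val v),
     derivable (fun t => restr F (t, p.2)) p.1 1
   & {for p, continuous (restr F)}].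
Proof.
case: p => l u dF.
have valc : continuous (val : subspace_type S -> X).
  exact: isometry_continuous.
have [dFu DFu] := differentiable_u dF.
have dval : is_diff u (val : subspace_type S -> X) val.
  by apply: DiffDef; [exact: linear_differentiable|rewrite diff_lin].
have d := is_diff_comp dval (differentiableP dFu).
split.
- by case: d.
- by move=> v; rewrite /D_u /=; case: d => _ ->; rewrite -DFu.
- exact: derivable_l dF.
- have c : (q.1, val q.2) @[q --> (l, u)] --> (l, val u).
    have c1 : q.1 @[q --> (l, u)] --> l by exact: cvg_fst.
    have c2 : q.2 @[q --> (l, u)] --> u by exact: cvg_snd.
    exact: (cvg_pair c1 (cvg_comp _ _ c2 (valc u))).
  exact: cvg_comp c (differentiable_continuous dF).
Qed.

End Restriction.

Lemma nbhs_setX_interior (R : realType) (X : normedModType R) (L : set R)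
    (U : set X) (mu : R) :
  open L -> L mu -> nbhs (0 : X) U -> nbhs (mu, 0 : X) (L `*` U°).
Proof.
move=> Lo Lmu U0; exists (L, U°) => //; split; first exact: open_nbhs_nbhs.
exact: (nbhs_interior U0).
Qed.

Lemma is_basis_neq0 (R : realType) (V : lmodType R) (A : set V) (k : nat)
    (e : 'I_k -> V) (i : 'I_k) : is_basis A e -> e i != 0.
Proof.
move=> [_ _ einj _]; apply/eqP => ei0.
have := einj (fun j => (j == i)%:R) _ i; rewrite eqxx => /(_ _)/wrap[].
  rewrite (bigD1 i)//= big1 => [|j /negbTE ->]; last exact: scale0r.
  by rewrite ei0 scaler0 addr0.
by move/eqP; rewrite oner_eq0.
Qed.

(** * Reduction to the abstract bifurcation theorem *)

Theorem proposition4p2 (R : realType) (X Y : completeNormedModType R)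
    (Lambda : set R) (U : set X) (F : R * X -> Y)
    (Lambda_open : open Lambda) (Lambda_itv : is_interval Lambda)
    (U_nbhs : nbhs (0 : X) U)
    (F_C1 : C1_on (Lambda `*` U°) F)
    (F_triv : forall l, Lambda l -> F (l, 0) = 0)
    (mu : R) (mu_Lambda : Lambda mu)
    (k : nat) (w : 'I_k -> X)
    (w_basis : is_basis (ker (D_u F (mu, 0))) w)
    (i : 'I_k) (X0 : submodClosed X)
    (X0_compl : is_complement (ker (D_u F (mu, 0))) X0)
    (Yt : submodClosed Y) (Yt_closed : closed [set` Yt]) :
  let Xt := subspace_type (line_plus (w i) X0) in
  let Ut : set Xt := [set u | U (val u)] in
  let Ft : R * Xt -> Y := restr F in
  forall
    (Ft_Yt : forall p, (Lambda `*` Ut) p -> Ft p \in Yt)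
    (Ft_dim : exists n, has_dim (ker (D_u Ft (mu, 0))) n /\
                has_codim_in [set` Yt] (range (D_u Ft (mu, 0))) n)
    (Ft_cross : D_lu_exists_continuous_on
                  (Lambda `*` [set u : Xt | U° (val u)]) Ft)
    (Ft_transversal :
      ~ range (D_u Ft (mu, 0)) (D_lu Ft (mu, 0) (line_plus_gen (w i) X0))),
  exists (delta0 : R) (lam : R -> R) (psi : R -> subspace_type X0),
    let I0 := `]- delta0, delta0[%classic in
    let u (s : R) : X := s *: w i + s *: val (psi s) in
    [/\ 0 < delta0,
        {within I0, continuous lam} /\ {within I0, continuous psi},
        lam 0 = mu /\ psi 0 = 0,
        forall s, I0 s -> [/\ Lambda (lam s), U (u s) & F (lam s, u s) = 0]
      & \forall p \near (mu, 0 : X), p.2 \in line_plus (w i) X0 ->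
          (F p = 0 <->
           p.2 = 0 \/ exists2 s, I0 s & p = (lam s, u s))].
Proof.
move=> Xt Ut Ft Ft_Yt [n [Ft_ker Ft_codim]] Ft_cross.
(* The boolean form keeps [done] from trying to refute this hypothesis, which
   would make every [//] below very slow. *)
move=> /asboolPn Ft_trans.
have [X0c [K0 _]] := X0_compl.
have [_ wK _ _] := w_basis.
have w0 := is_basis_neq0 i w_basis.
pose A0 := Lambda `*` U°.
have nearA0 : nbhs (mu, 0 : X) A0 := nbhs_setX_interior Lambda_open mu_Lambda U_nbhs.
have A00 : A0 (mu, 0) by exact: nbhs_singleton nearA0.
have nearXt := near_subspace (line_plus (w i) X0) nearA0.
have nearL : \forall l \near mu, F (l, 0) = 0.
  have : nbhs mu Lambda by exact: open_nbhs_nbhs.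
  by apply: filterS => l /F_triv.
have F_restr (p : R * Xt) (Ap : A0 (p.1, val p.2)) :=
  differentiable_restr (F_C1.1 _ Ap).
have A0Ut (p : R * Xt) : A0 (p.1, val p.2) -> (Lambda `*` Ut) p.
  by move=> [? /interior_subset].
have F_diff0 := F_C1.1 _ A00.
have [A_diff DE _ _] := F_restr (mu, 0 : Xt) A00.
have [_ DuFE] := differentiable_u F_diff0.
have [A [Ac AE]] : exists A : {linear Xt -> Y},
    continuous A /\ forall v, D_u Ft (mu, 0) v = A v.
  by exists ('d (fun u => Ft (mu, u)) (0 : Xt)); split=> //; exact: diff_continuous.
have [B [Bc BE]] : exists B : {linear Xt -> Y},
    continuous B /\ forall v, D_lu Ft (mu, 0) v = B v.
  exists ('d (fun u => D_l Ft (mu, u)) (0 : Xt)); split=> //.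
  by apply: diff_continuous; exact: (Ft_cross.1 (mu, 0 : Xt) A00).
have AEval v : A v = D_u F (mu, 0) (val v) by rewrite -AE DuFE; exact: DE.
have kerX0 y : y \in X0 -> D_u F (mu, 0) y = 0 -> y = 0.
  by move=> yX0 Ky; have : [set 0] y by rewrite -K0.
(* [j] is the inclusion of X0 into X~, with X0 complete because it is closed. *)
have [j jE] : exists j : {linear closed_subspace X0c -> Xt},
    forall v, val (j v) = val (v : subspace_type X0).
  have jP (y : subspace_type X0) : val y \in line_plus (w i) X0.
    by apply/asboolP; exists 0, (val y);
      rewrite scale0r add0r; split => //; exact: valP.
  pose j0 (y : closed_subspace X0c) : Xt :=
    exist _ (val (y : subspace_type X0)) (jP y).
  have jlin : linear j0 by move=> a x y; exact: val_inj.
  pose j1 : {linear closed_subspace X0c -> Xt} :=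
    HB.pack j0 (GRing.isLinear.Build _ _ _ _ j0 jlin).
  by exists j1.
have jn v : `|j v| = `|v| by rewrite -norm_val jE.
pose wt : Xt := line_plus_gen (w i) X0.
have jw u : exists s v, u = s *: wt + j v.
  have /asboolP[s [y [yX0 uE]]] := valP u.
  pose v : closed_subspace X0c := exist _ y yX0; exists s, v; apply: val_inj.
  by transitivity (s *: w i + val (j v)); first by rewrite jE.
have Aw : A wt = 0 by rewrite AEval; exact: wK.
have Aj0 v : A (j v) = 0 -> v = 0.
  rewrite AEval jE => H; apply: val_inj.
  exact: (kerX0 _ (valP (v : subspace_type X0)) H).
have wt0 : wt != 0 by apply: contra w0 => /eqP/(congr1 val)/= ->.
have kerE x : ker (D_u Ft (mu, 0)) x <-> exists a, x = a *: wt.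
  rewrite /ker /= AE; split=> [|[a ->]]; last by rewrite linearZ/= Aw scaler0.
  have [a [v ->]] := jw x; rewrite linearD linearZ/= Aw scaler0 add0r => /Aj0 ->.
  by exists a; rewrite linear0 addr0.
have rangeE : range (D_u Ft (mu, 0)) = range A.
  by congr image; apply/funext => v; exact: AE.
(* The kernel is a line, so the common value of dimension and codimension is 1. *)
have n1 := has_dim_line wt0 kerE Ft_ker; rewrite {n Ft_ker}n1 in Ft_codim.
rewrite {}rangeE in Ft_codim Ft_trans.
have Btrans : ~ range A (B wt) by rewrite -BE; apply/asboolPn.
have AYt v : A v \in Yt.
  by case: Ft_codim => e [+ _ _ _] => /(_ (A v)); apply; exists v.
(* Closedness of [Yt] is used twice: [D_l Ft] takes values in it near (mu, 0), then so does its
   derivative in u. *)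
have BYt v : B v \in Yt.
  have [r r0 rA] := near_pair0P nearXt.
  have Dd : differentiable (fun u => D_l Ft (mu, u)) (0 : Xt).
    exact: (Ft_cross.1 (mu, 0 : Xt) A00).
  rewrite -BE /D_lu /D_u -deriveE//.
  apply: derive_closed_subspace => //; first exact: diff_derivable.
  apply/nbhs_ballP; exists r => // u; rewrite -ball_normE/= sub0r normrN => ur.
  have murA : A0 (mu, val u) by apply: rA => //; rewrite subrr normr0.
  rewrite /D_l derive1E; apply: derive_closed_subspace => //.
    by have [_ _ + _] := F_restr (mu, u) murA.
  apply/nbhs_ballP; exists r => // t; rewrite -ball_normE/= distrC => tr.
  by apply/Ft_Yt/A0Ut; exact: rA.
have lin_range a x y : range A x -> range A y -> range A (a *: x + y).
  by move=> [x' _ <-] [y' _ <-]; exists (a *: x' + y'); rewrite // linearP.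
have [d [lam [psi [d0 cont [lam0 psi0] zero locus]]]] : exists (d : R) (lam : R -> R)
    (psi : R -> closed_subspace X0c),
    let u s := s *: wt + s *: j (psi s) in
    [/\ 0 < d,
        forall s, `|s| < d -> {for s, continuous lam} /\ {for s, continuous psi},
        lam 0 = mu /\ psi 0 = 0,
        forall s, `|s| < d -> (Lambda `*` Ut) (lam s, u s) /\ Ft (lam s, u s) = 0
      & \forall p \near (mu, 0 : Xt), Ft p = 0 <->
          p.2 = 0 \/ exists2 s, `|s| < d & p = (lam s, u s)].
  apply: (bifurcation Yt_closed jn wt0 jw _ _ _ _ Ac Bc Aw).
  - apply: filterS nearXt => p Ap; have [_ _ _ ?] := F_restr p Ap.
    by split => //; [exact: A0Ut|exact/Ft_Yt/A0Ut].
  - exact: nearL.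
  - move=> e e0; have [|r r0 rP] :=
      @strict_derivative_u R Xt Y Ft mu e e0; last first.
      by exists r => // l u v; rewrite -AE; exact: rP.
    have : \forall p \near (mu, 0 : X), A0 p /\
        forall v, `|'d F p v - 'd F (mu, 0) v| <= e * `|v|.
      have := F_C1.2 _ A00 e e0; rewrite near_withinE => H.
      by apply: filterS2 nearA0 H => p Ap /(_ Ap).
    move=> /(near_subspace (line_plus (w i) X0)); apply: filterS => p [Ap H].
    have [? DEp _ _] := F_restr p Ap; split=> // v; rewrite DEp DE.
    by rewrite (le_trans (H _))// prod_normE/= normr0 max_r.
  - move=> e e0; have [| |r r0 rP] := @strict_derivative_lu R Xt Y Ft mu e e0.
    + exact: nearL.
    + have := Ft_cross.2 (mu, 0 : Xt) A00 e e0; rewrite near_withinE => H.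
      apply: filterS2 nearXt H => p Ap /(_ Ap) H.
      have [_ _ ? _] := F_restr p Ap; split=> //.
      exact: (Ft_cross.1 p Ap).
    + by exists r => // l m u; rewrite -BE; exact: rP.
  - by move=> a v; rewrite rpredD ?rpredZ.
  (* If a is nonzero, then B w_i = A (- a^-1 v), against transversality. *)
  - move=> a v; have [->|a0 H] := eqVneq a 0.
      by rewrite scale0r add0r => /Aj0 ->.
    exfalso; apply: Btrans; exists (- a^-1 *: j v) => //.
    rewrite linearZ/= scaleNr -scalerN -(addKr (a *: B wt) (A (j v))) H addr0 opprK.
    by rewrite scalerA mulVf// scale1r.
  (* Modulo the range of [A], y is a multiple of B w_i; [A] kills the w_i component of a preimage of
     the difference, which leaves a vector of X0. *)
  - move=> y Yy.
    have [a [x _ xE]] := codim1_span lin_range Ft_codim (BYt wt) Btrans Yy.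
    have [b [v xE']] := jw x; exists a, v.
    by rewrite -[LHS](subrK (a *: B wt)) -xE xE' linearD linearZ/=
      Aw scaler0 add0r addrC.
exists d, lam, psi => /=.
have Id s : `]- d, d[%classic s <-> `|s| < d by rewrite /= in_itv/= ltr_norml.
have uE s : val (s *: wt + s *: j (psi s)) =
    s *: w i + s *: val (psi s : subspace_type X0).
  by rewrite -jE.
split => //.
- split; rewrite continuous_open_subspace; try exact: interval_open.
    by move=> s /set_mem/Id sd; have [] := cont s sd.
  by move=> s /set_mem/Id sd; have [] := cont s sd.
- by move=> s /Id /zero [[? ?]]; rewrite -uE.
- apply: filterS (near_subspaceW locus) => -[l x] /= H Sx.
  have {H} := H Sx; rewrite /Ft /restr /= => ->.
  split=> -[/= x0|[s sd]]; first by left; have /= := congr1 val x0.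
  - case=> -> xE; right; exists s; first exact/Id.
    by rewrite xE -uE.
  - by left; apply: val_inj.
  - case=> -> xE; right; exists s; first exact/Id.
    by congr pair; apply: val_inj; rewrite uE.
Qed.
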